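(* Let $\mathcal H=\mathcal H_1\oplus\mathcal H_2$ be a finite-dimensional Hilbert space, $d_\alpha=\dim\mathcal H_\alpha\geq 1$, and let $G$ be a finite (or compact) group of unitaries on $\mathcal H$ preserving $\mathcal H_1$ and $\mathcal H_2$. Assume that the only trivial subrepresentations of the natural representation $U\mapsto\hat U=U\otimes U^*$ of $G$ on $\mathcal H\otimes\mathcal H$ are those spanned by $|\mathbb 1_1\rangle\rangle$ and $|\mathbb 1_2\rangle\rangle$, i.e. the space of $G$-invariant vectors is $\operatorname{span}\{|\mathbb 1_1\rangle\rangle,|\mathbb 1_2\rangle\rangle\}$. Let $\Lambda$ be a quantum channel (completely positive, trace preserving) on $\mathcal H$, with leakage $L$ and seepage $S$ as defined in the context, and let $\rho$ be a density matrix supported on $\mathcal H_1$. Let $$S_0(N)=\frac1{|G|^{N+1}}\sum_{U_0,\dots,U_N\in G}\langle\langle\mathbb 1_1|\hat\Lambda\hat U_{N+1}\hat\Lambda\hat U_N\cdots\hat\Lambda\hat U_2\hat\Lambda\hat U_1\hat U_0|\rho\rangle\rangle,\qquad U_{N+1}=U_1^\dagger\cdots U_N^\dagger$$ (Haar averages if $G$ is compact). Then there are constants $A,B,\lambda\in\mathbb R$ independent of $N$, with $\lambda=1-L-S$, such that for all $N\ge1$ $$S_0(N)=A\lambda^N+B,$$ and $$L=(1-B)(1-\lambda),\qquad S=B(1-\lambda).$$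
   Context: Liouville representation: a matrix $\rho=\sum\rho_{kl}|k\rangle\langle l|$ is identified with $|\rho\rangle\rangle=\sum\rho_{kl}|k\rangle\otimes|l\rangle\in\mathcal H\otimes\mathcal H$, $\langle\langle\sigma|\rho\rangle\rangle=\operatorname{Tr}(\sigma^\dagger\rho)$; a channel $\Lambda(\rho)=\sum_kA_k\rho A_k^\dagger$ has matrix $\hat\Lambda=\sum_kA_k\otimes A_k^*$. $\mathbb 1_\alpha$ denotes the orthogonal projector onto $\mathcal H_\alpha$, $\alpha=1,2$. Leakage and seepage: $L=\frac1{d_1}\langle\langle\mathbb 1_2|\hat\Lambda|\mathbb 1_1\rangle\rangle$, $S=\frac1{d_2}\langle\langle\mathbb 1_1|\hat\Lambda|\mathbb 1_2\rangle\rangle$; equivalently, the average over unit vectors $\psi_1\in\mathcal H_1$ (resp. $\psi_2\in\mathcal H_2$) of the probability that $\Lambda$ moves the state to $\mathcal H_2$ (resp. $\mathcal H_1$). State preparation and measurement errors are taken to be trivial, and the gate error $\Lambda$ is the same for all gates. *)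

(* Defs.v *)
From HB Require Import structures.
From mathcomp Require Import all_boot all_order all_algebra.
From mathcomp Require Import finmap sesquilinear spectral complex mxtens.
From mathcomp Require Import all_classical all_reals all_analysis.

Set Implicit Arguments.
Unset Strict Implicit.
Unset Printing Implicit Defensive.

Import Order.TTheory GRing.Theory Num.Theory numFieldNormedType.Exports.

Local Open Scope classical_set_scope.
Local Open Scope ring_scope.
Local Open Scope complex_scope.
Local Open Scope sesquilinear_scope.

(* The usual topology of the complex numbers, through the modulus. *)
HB.instance Definition _ (R : realType) :=
  NormedModule.copy R[i] (R[i] : numFieldType)^o.

Section Liouville.
Context {C : numClosedFieldType} {n : nat}.
Implicit Types (A B U rho sigma : 'M[C]_n) (X : 'M[C]_(n * n)).

Definition ket (k : 'I_n) : 'cV[C]_n := delta_mx k 0.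

(* |A>> = \sum_(k, l) A_kl |k> (x) |l> *)
Definition lvec A : 'cV[C]_(n * n) :=
  \sum_k \sum_l A k l *: (ket k *t ket l : 'cV_(n * n)).

(* <<sigma| X |rho>> *)
Definition braket sigma X rho : C := ((lvec sigma)^t* *m X *m lvec rho) 0 0.

(* The natural representation U (x) U^*, with U^* the entrywise conjugate. *)
Definition uhat U : 'M[C]_(n * n) := U *t map_mx Num.conj U.

(* The matrix of a superoperator L in the basis |k> (x) |l> = | |k><l| >>;
   liouvilleP and liouville_kraus below give its characterisation and its
   expression as \sum_k A_k (x) A_k^*. *)
Definition liouville (L : 'M[C]_n -> 'M[C]_n) : 'M[C]_(n * n) :=
  \matrix_(i, j) lvec (L (delta_mx (mxtens_unindex j).1 (mxtens_unindex j).2))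
                      i 0.

Lemma lvecE A i j : lvec A (mxtens_index (i, j)) 0 = A i j.
Proof.
have e0 : (0 : 'I_(1 * 1)) = mxtens_index (0 : 'I_1, 0 : 'I_1).
  exact: val_inj.
rewrite /lvec summxE (bigD1 i)//= summxE (bigD1 j)//= mxE.
rewrite [X in _ * X](_ : _ = 1); last first.
  transitivity ((ket i *t ket j) (mxtens_index (i, j))
                                 (mxtens_index (0 : 'I_1, 0 : 'I_1))).
    by congr (fun_of_matrix _ _ _); exact: val_inj.
  by rewrite tensmxE !mxE !eqxx mulr1.
rewrite mulr1 [X in _ + X + _]big1 ?addr0 => [|l ne]; last first.
  rewrite mxE [X in _ * X](_ : _ = 0) ?mulr0//.
  transitivity ((ket i *t ket l) (mxtens_index (i, j))
                                 (mxtens_index (0 : 'I_1, 0 : 'I_1))).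
    by congr (fun_of_matrix _ _ _); exact: val_inj.
  by rewrite tensmxE !mxE [j == l]eq_sym (negPf ne) mulr0.
rewrite big1 ?addr0// => k ne; rewrite summxE big1// => l _.
rewrite mxE [X in _ * X](_ : _ = 0) ?mulr0//.
transitivity ((ket k *t ket l) (mxtens_index (i, j))
                               (mxtens_index (0 : 'I_1, 0 : 'I_1))).
  by congr (fun_of_matrix _ _ _); exact: val_inj.
by rewrite tensmxE !mxE [i == k]eq_sym (negPf ne) mul0r.
Qed.

Lemma sum_mxtens (F : 'I_(n * n) -> C) :
  \sum_k F k = \sum_i \sum_j F (mxtens_index (i, j)).
Proof.
rewrite pair_big (reindex (@mxtens_index n n)) /=; last first.
  exists (@mxtens_unindex n n) => x _; first exact: mxtens_indexK.
  exact: mxtens_unindexK.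
by apply: eq_bigr => -[].
Qed.

Lemma lvec_dot sigma rho :
  ((lvec sigma)^t* *m lvec rho) 0 0 = \tr (sigma^t* *m rho).
Proof.
rewrite mxE sum_mxtens exchange_big /mxtrace; apply: eq_bigr => j _.
by rewrite mxE; apply: eq_bigr => i _; rewrite !mxE !lvecE.
Qed.

Lemma liouvilleP (L : {linear 'M[C]_n -> 'M[C]_n}) A :
  liouville L *m lvec A = lvec (L A).
Proof.
apply/matrixP => i j; rewrite ord1 {j}; case: (mxtens_indexP i) => a b.
rewrite mxE sum_mxtens lvecE [in RHS](matrix_sum_delta A) linear_sum summxE.
apply: eq_bigr => k _; rewrite linear_sum summxE; apply: eq_bigr => l _.
by rewrite !mxE mxtens_indexK lvecE/= lvecE linearZ mxE mulrC.
Qed.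

Lemma liouville_kraus (r : nat) (A : 'I_r -> 'M[C]_n) :
  liouville (fun rho => \sum_k A k *m rho *m (A k)^t*) = \sum_k uhat (A k).
Proof.
apply/matrixP => i j; case: (mxtens_indexP i) => a b.
case: (mxtens_indexP j) => c d.
rewrite mxE mxtens_indexK lvecE !summxE; apply: eq_bigr => k _ /=.
rewrite tensmxE mxE (bigD1 d)//= big1 ?addr0 => [|l ne].
  rewrite mxE (bigD1 c)//= big1 ?addr0 => [|m ne].
    by rewrite !mxE !eqxx mulr1.
  by rewrite !mxE (negPf ne) mulr0.
rewrite mxE big1 ?mul0r// => m _.
by rewrite !mxE (negPf ne) andbF mulr0.
Qed.

End Liouville.

Section Channels.
Context {C : numClosedFieldType}.

(* On a numClosedFieldType, 0 <= z entails that z is real. *)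
Definition psd {m : nat} (A : 'M[C]_m) : Prop :=
  forall v : 'cV[C]_m, 0 <= (v^t* *m A *m v) 0 0.

(* (id (x) L)(X) on C^k (x) C^n, applying L to each n x n block of X. *)
Definition ampliation {n : nat} (k : nat) (L : 'M[C]_n -> 'M[C]_n)
    (X : 'M[C]_(k * n)) : 'M[C]_(k * n) :=
  \sum_(i < k) \sum_(j < k) delta_mx i j *t
    L (\matrix_(a, b) X (mxtens_index (i, a)) (mxtens_index (j, b))).

Definition completely_positive {n : nat} (L : 'M[C]_n -> 'M[C]_n) : Prop :=
  forall (k : nat) (X : 'M[C]_(k * n)), psd X -> psd (ampliation L X).

Definition trace_preserving {n : nat} (L : 'M[C]_n -> 'M[C]_n) : Prop :=
  forall A, \tr (L A) = \tr A.

Definition channel {n : nat} (L : {linear 'M[C]_n -> 'M[C]_n}) : Prop :=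
  completely_positive L /\ trace_preserving L.

Definition density {n : nat} (rho : 'M[C]_n) : Prop :=
  psd rho /\ \tr rho = 1.

(* The support of a positive semidefinite matrix is its range. *)
Definition supported_on {n : nat} (rho : 'M[C]_n) (H : {vspace 'cV[C]_n}) :
    Prop :=
  forall v : 'cV[C]_n, rho *m v \in H.

Definition orthogonal_sum {n : nat} (H1 H2 : {vspace 'cV[C]_n}) : Prop :=
  (forall u v : 'cV[C]_n, u \in H1 -> v \in H2 -> u^t* *m v = 0) /\
  (H1 + H2 = fullv)%VS.

Definition orthogonal_projector {n : nat} (P : 'M[C]_n)
    (H : {vspace 'cV[C]_n}) : Prop :=
  [/\ P^t* = P, P *m P = P & forall v : 'cV[C]_n, v \in H <-> P *m v = v].

Definition unitary_group {n : nat} (G : set 'M[C]_n) : Prop :=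
  [/\ G 1%:M,
      forall U V, G U -> G V -> G (U *m V),
      forall U, G U -> G (U^t*) &
      forall U, G U -> U \is unitarymx].

Definition preserves {n : nat} (G : set 'M[C]_n) (H : {vspace 'cV[C]_n}) :
    Prop :=
  forall U, G U -> forall v : 'cV[C]_n, v \in H -> U *m v \in H.

Definition invariant_vector {n : nat} (G : set 'M[C]_n)
    (x : 'cV[C]_(n * n)) : Prop :=
  forall U, G U -> uhat U *m x = x.

(* (1/d_1) <<1_2|L|1_1>> *)
Definition leakage {n : nat} (d1 : nat) (P1 P2 : 'M[C]_n)
    (L : 'M[C]_n -> 'M[C]_n) : C :=
  d1%:R^-1 * braket P2 (liouville L) P1.

(* (1/d_2) <<1_1|L|1_2>> *)
Definition seepage {n : nat} (d2 : nat) (P1 P2 : 'M[C]_n)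
    (L : 'M[C]_n -> 'M[C]_n) : C :=
  d2%:R^-1 * braket P1 (liouville L) P2.

(* U_{N+1} = U_1^dagger ... U_N^dagger *)
Definition recovery_gate {n : nat} (N : nat) (U : nat -> 'M[C]_n) : 'M[C]_n :=
  \big[mulmx/1%:M]_(1 <= i < N.+1) (U i)^t*.

(* L U_{N+1} (L U_N) ... (L U_1) U_0, in the Liouville representation. *)
Definition rb_sequence {n : nat} (L : 'M[C]_n -> 'M[C]_n) (N : nat)
    (U : nat -> 'M[C]_n) : 'M[C]_(n * n) :=
  liouville L *m uhat (recovery_gate N U) *m
  (\big[mulmx/1%:M]_(i <- rev (iota 1 N)) (liouville L *m uhat (U i))) *m
  uhat (U 0%N).

Definition rb_survival {n : nat} (P : 'M[C]_n) (L : 'M[C]_n -> 'M[C]_n)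
    (rho : 'M[C]_n) (N : nat) (U : nat -> 'M[C]_n) : C :=
  braket P (rb_sequence L N U) rho.

(* S_0(N) for finite G; the tuple t lists U_0, ..., U_N. *)
Definition S0_finite {n : nat} (G : set 'M[C]_n) (P : 'M[C]_n)
    (L : 'M[C]_n -> 'M[C]_n) (rho : 'M[C]_n) (N : nat) : C :=
  ((#|` fset_set G|%fset)%:R ^+ N.+1)^-1 *
  \sum_(t \in [set t : N.+1.-tuple 'M[C]_n | forall i, G (tnth t i)])
    rb_survival P L rho N (nth 1%:M t).

End Channels.

Section Haar.
Context {R : realType} {n : nat}.

Definition borel_mx := g_sigma_algebraType (@open 'M[R[i]]_n).

(* The Haar probability of a compact group G of matrices, as a Borel measure
   on the space of matrices, carried by G. *)
Definition haar (G : set 'M[R[i]]_n) (mu : probability borel_mx R) : Prop :=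
  mu (G : set borel_mx) = 1%E /\
  forall U, G U -> forall A : set borel_mx, measurable A ->
    mu ((fun V : 'M[R[i]]_n => U *m V) @^-1` A) = mu A.

Definition cintegral (mu : probability borel_mx R) (G : set 'M[R[i]]_n)
    (f : 'M[R[i]]_n -> R[i]) : R[i] :=
  (\int[mu]_(U in (G : set borel_mx)) complex.Re (f U)) +i*
  (\int[mu]_(U in (G : set borel_mx)) complex.Im (f U)).

(* Average of f over m independent Haar-distributed elements of G. *)
Fixpoint haar_average (mu : probability borel_mx R) (G : set 'M[R[i]]_n)
    (m : nat) (f : seq 'M[R[i]]_n -> R[i]) : R[i] :=
  if m is m'.+1 then
    cintegral mu G (fun U => haar_average mu G m' (fun s => f (U :: s)))
  else f [::].

(* S_0(N) for compact G. *)
Definition S0_haar (mu : probability borel_mx R) (G : set 'M[R[i]]_n)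
    (P : 'M[R[i]]_n) (L : 'M[R[i]]_n -> 'M[R[i]]_n) (rho : 'M[R[i]]_n)
    (N : nat) : R[i] :=
  haar_average mu G N.+1 (fun s => rb_survival P L rho N (nth 1%:M s)).

End Haar.

Definition rb_decay {R : realType} (L S : R[i]) (S0 : nat -> R[i]) : Prop :=
  exists A B lambda : R,
    [/\ lambda%:C = 1 - L - S,
        forall N : nat, (1 <= N)%N -> S0 N = (A * lambda ^+ N + B)%:C,
        L = ((1 - B) * (1 - lambda))%:C &
        S = (B * (1 - lambda))%:C].

(* Main.v *)
From HB Require Import structures.
Require Import Defs.
From mathcomp Require Import all_boot all_order all_algebra ring lra.
From mathcomp Require Import finmap sesquilinear spectral complex mxtens.
From mathcomp Require Import all_classical all_reals all_analysis.
From mathcomp Require Import measurable_realfun.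
Import Order.TTheory GRing.Theory Num.Theory numFieldNormedType.Exports.
Local Open Scope classical_set_scope.
Local Open Scope ring_scope.
Local Open Scope complex_scope.

Set Implicit Arguments.
Unset Strict Implicit.
Unset Printing Implicit Defensive.

(* Write V for the matrix uhat U and E for the matrix of the channel.
   Integrating out the last gate of the circuit first replaces the operator T
   standing between the recovery gate and the rest, initially 1, by its twirl
   tw(T), the mean of V^t* T E V.  The mean of V is the orthogonal projector Pi
   onto span {|1_1>>, |1_2>>}: by left invariance its range consists of
   invariant vectors, and it fixes the bras <<1_1| and <<1_2|.  Hence
   Pi tw(T) = tw(T) Pi = Pi T E Pi, and the whole average collapses to
   <<1_1| E (Pi E)^N Pi |rho>>.  On the span, Pi E is a two-state Markov chain
   leaving H_1 with probability L and H_2 with probability S, so the weight u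
   on H_1 obeys u' = (1 - L - S) u + S, starting from u = 1.  If L + S <> 0 the
   constant B is the stationary weight S / (L + S); otherwise positivity of the
   channel forces L = S = 0, and B = 1. *)

(** This monoid structure lets the noncommutative [\big[mulmx/1%:M]] products of gates be split at
    their last factor. *)
HB.instance Definition _ (R : pzRingType) (n : nat) :=
  Monoid.isLaw.Build 'M[R]_n 1%:M (@mulmx R n n n)
    (@mulmxA R n n n n) (@mul1mx R n n) (@mulmx1 R n n).

(** * Multiplicativity and adjoints of the natural representation *)

Section Liouville_algebra.
Local Open Scope sesquilinear_scope.
Context {C : numClosedFieldType}.

Lemma adjmx_mul m n p (A : 'M[C]_(m, n)) (B : 'M[C]_(n, p)) :
  (A *m B)^t* = B^t* *m A^t*.
Proof. by rewrite trmx_mul map_mxM. Qed.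

Lemma uhatM n (A B : 'M[C]_n) : uhat (A *m B) = uhat A *m uhat B.
Proof. by rewrite /uhat map_mxM tensmx_mul. Qed.

Lemma uhat1 n : uhat (1%:M : 'M[C]_n) = 1%:M.
Proof.
rewrite /uhat map_mx1; apply/matrixP => i j.
case: (mxtens_indexP i) => a b; case: (mxtens_indexP j) => c d.
rewrite tensmxE !mxE -natrM mulnb; congr (_%:R); congr nat_of_bool.
by rewrite (can_eq (@mxtens_indexK _ _)) xpair_eqE.
Qed.

Lemma uhat_adj n (A : 'M[C]_n) : uhat (A^t*) = (uhat A)^t*.
Proof. by rewrite /uhat trmx_tens map_mxT !map_trmx. Qed.

Lemma braket_lvec n (L : {linear 'M[C]_n -> 'M[C]_n}) (A B : 'M[C]_n) :
  braket A (liouville L) B = \tr (A^t* *m L B).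
Proof. by rewrite /braket -mulmxA liouvilleP lvec_dot. Qed.

End Liouville_algebra.

(** * Invariant means on a matrix group, extended entrywise to matrices *)

Section Mean.
Local Open Scope sesquilinear_scope.
Context {C : numClosedFieldType} {n : nat}.

(* [K] is the algebra of functions on which [M] is linear: all functions for a
   finite group, the continuous ones for a compact group. *)
Record invariant_mean (G : set 'M[C]_n) (K : ('M[C]_n -> C) -> Prop)
    (M : ('M[C]_n -> C) -> C) : Prop := InvariantMean {
  domain_entry : forall i j, K (fun U => U i j);
  domain_cst : forall a, K (fun=> a);
  domain_add : forall f g, K f -> K g -> K (fun U => f U + g U);
  domain_mul : forall f g, K f -> K g -> K (fun U => f U * g U);
  domain_conj : forall f, K f -> K (fun U => (f U)^*%R);
  mean_linear : forall a f g, K f -> K g ->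
    M (fun U => a * f U + g U) = a * M f + M g;
  mean_conj : forall f, K f -> M (fun U => (f U)^*%R) = (M f)^*%R;
  mean_cst : forall a, M (fun=> a) = a;
  mean_ext : forall f g, {in G, f =1 g} -> M f = M g;
  mean_invariant : forall V f, G V -> K f -> M (fun U => f (V *m U)) = M f
}.

(** This is the recursion of [haar_average] for an arbitrary mean, so that both kinds of average
    share one argument. The head of the list is averaged outermost, hence the last gate
    innermost. *)
Fixpoint iterated_mean (M : ('M[C]_n -> C) -> C) (m : nat)
    (f : seq 'M[C]_n -> C) : C :=
  if m is m'.+1 then M (fun U => iterated_mean M m' (fun s => f (U :: s)))
  else f [::].

Definition mean_mx (M : ('M[C]_n -> C) -> C) {p q : nat}
    (F : 'M[C]_n -> 'M[C]_(p, q)) : 'M[C]_(p, q) :=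
  \matrix_(i, j) M (fun U => F U i j).

Definition domain_mx (K : ('M[C]_n -> C) -> Prop) {p q : nat}
    (F : 'M[C]_n -> 'M[C]_(p, q)) : Prop :=
  forall i j, K (fun U => F U i j).

Context {G : set 'M[C]_n} {K : ('M[C]_n -> C) -> Prop}
  {M : ('M[C]_n -> C) -> C}.
Hypothesis hM : invariant_mean G K M.

Lemma domain_sum (I : Type) (s : seq I) (f : I -> 'M[C]_n -> C) :
  (forall i, K (f i)) -> K (fun U => \sum_(i <- s) f i U).
Proof.
move=> Kf; elim: s => [|i s IHs].
  rewrite (_ : (fun U => _) = fun=> 0); first exact: (domain_cst hM).
  by apply/funext => U; rewrite big_nil.
rewrite (_ : (fun U => _) = fun U => f i U + \sum_(j <- s) f j U).
  exact: (domain_add hM (Kf i) IHs).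
by apply/funext => U; rewrite big_cons.
Qed.

Lemma mean_sum (I : Type) (s : seq I) (a : I -> C) (f : I -> 'M[C]_n -> C) :
  (forall i, K (f i)) ->
  M (fun U => \sum_(i <- s) a i * f i U) = \sum_(i <- s) a i * M (f i).
Proof.
move=> Kf; elim: s => [|i s IHs].
  rewrite big_nil -[RHS](mean_cst hM); congr M.
  by apply/funext => U; rewrite big_nil.
rewrite big_cons -IHs -(mean_linear hM) //; last first.
  apply: domain_sum => j; apply: (domain_mul hM) (Kf j); exact: (domain_cst hM).
by congr M; apply/funext => U; rewrite big_cons.
Qed.

Lemma domain_mx_cst p q (A : 'M[C]_(p, q)) : domain_mx K (fun=> A).
Proof. by move=> i j; exact: (domain_cst hM). Qed.

Lemma domain_mx_mul p q r (E : 'M[C]_n -> 'M[C]_(p, q))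
    (F : 'M[C]_n -> 'M[C]_(q, r)) :
  domain_mx K E -> domain_mx K F -> domain_mx K (fun U => E U *m F U).
Proof.
move=> KE KF i j; rewrite (_ : (fun U => _) =
  fun U => \sum_k E U i k * F U k j); last by apply/funext => U; rewrite mxE.
by apply: domain_sum => k; exact: (domain_mul hM (KE i k) (KF k j)).
Qed.

Lemma domain_mx_adj p q (F : 'M[C]_n -> 'M[C]_(p, q)) :
  domain_mx K F -> domain_mx K (fun U => (F U)^t*).
Proof.
move=> KF i j; rewrite (_ : (fun U => _) = fun U => (F U j i)^*%R).
  exact: (domain_conj hM (KF j i)).
by apply/funext => U; rewrite !mxE.
Qed.

Lemma domain_uhat : domain_mx K uhat.
Proof.
move=> i j; case: (mxtens_indexP i) => a b; case: (mxtens_indexP j) => c d.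
rewrite (_ : (fun U => _) = fun U : 'M[C]_n => U a c * (U b d)^*%R).
  apply: (domain_mul hM); first exact: (domain_entry hM).
  exact: (domain_conj hM (domain_entry hM _ _)).
by apply/funext => U; rewrite tensmxE mxE.
Qed.

Lemma mean_mx_cst p q (A : 'M[C]_(p, q)) : mean_mx M (fun=> A) = A.
Proof. by apply/matrixP => i j; rewrite mxE (mean_cst hM). Qed.

Lemma mean_mx_ext p q (E F : 'M[C]_n -> 'M[C]_(p, q)) :
  {in G, E =1 F} -> mean_mx M E = mean_mx M F.
Proof.
move=> eEF; apply/matrixP => i j; rewrite !mxE; apply: (mean_ext hM).
by move=> U GU; rewrite eEF.
Qed.

Lemma mean_mulmxl p q r (A : 'M[C]_(p, q)) (F : 'M[C]_n -> 'M[C]_(q, r)) :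
  domain_mx K F -> mean_mx M (fun U => A *m F U) = A *m mean_mx M F.
Proof.
move=> KF; apply/matrixP => i j; rewrite !mxE.
under [RHS]eq_bigr do rewrite mxE.
rewrite -(mean_sum _ _ (fun k => KF k j)); congr M.
by apply/funext => U; rewrite mxE.
Qed.

Lemma mean_mulmxr p q r (A : 'M[C]_(q, r)) (F : 'M[C]_n -> 'M[C]_(p, q)) :
  domain_mx K F -> mean_mx M (fun U => F U *m A) = mean_mx M F *m A.
Proof.
move=> KF; apply/matrixP => i j; rewrite !mxE.
under [RHS]eq_bigr do rewrite mxE mulrC.
rewrite -(mean_sum _ _ (fun k => KF i k)); congr M.
by apply/funext => U; rewrite mxE; under eq_bigr do rewrite mulrC.
Qed.

Lemma mean_mx_adj p q (F : 'M[C]_n -> 'M[C]_(p, q)) :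
  domain_mx K F -> mean_mx M (fun U => (F U)^t*) = (mean_mx M F)^t*.
Proof.
move=> KF; apply/matrixP => i j; rewrite !mxE -(mean_conj hM (KF j i)).
by congr M; apply/funext => U; rewrite !mxE.
Qed.

Lemma mean_mx_invariant p q (V : 'M[C]_n) (F : 'M[C]_n -> 'M[C]_(p, q)) :
  G V -> domain_mx K F -> mean_mx M (fun U => F (V *m U)) = mean_mx M F.
Proof.
move=> GV KF; apply/matrixP => i j; rewrite !mxE.
exact: (mean_invariant hM GV (KF i j)).
Qed.

End Mean.

(** * Averaging the gates of the circuit one at a time *)

Section Twirl.
Local Open Scope sesquilinear_scope.
Context {C : numClosedFieldType} {n : nat}.

Definition twirl (M : ('M[C]_n -> C) -> C) (Lh T : 'M[C]_(n * n)) :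
    'M[C]_(n * n) :=
  mean_mx M (fun U => uhat (U^t*) *m T *m Lh *m uhat U).

Context {G : set 'M[C]_n} {K : ('M[C]_n -> C) -> Prop}
  {M : ('M[C]_n -> C) -> C}.
Hypothesis hM : invariant_mean G K M.
Implicit Types (T Lh : 'M[C]_(n * n)) (U : 'M[C]_n).

Lemma domain_uhat_adj : domain_mx K (fun U => uhat (U^t*)).
Proof.
rewrite (_ : (fun U => _) = fun U => (uhat U)^t*).
  exact: (domain_mx_adj hM (domain_uhat hM)).
by apply/funext => U; rewrite uhat_adj.
Qed.

Lemma domain_twirl Lh T :
  domain_mx K (fun U => uhat (U^t*) *m T *m Lh *m uhat U).
Proof.
apply: (domain_mx_mul hM); last exact: (domain_uhat hM).
apply: (domain_mx_mul hM); last exact: (domain_mx_cst hM).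
apply: (domain_mx_mul hM); last exact: (domain_mx_cst hM).
exact: domain_uhat_adj.
Qed.

(* The circuit of [rb_sequence] with [T] inserted after the recovery gate:
   averaging over the last gate replaces [T] by [twirl T]. *)
Definition rb_sequence_with (L : 'M[C]_n -> 'M[C]_n) T (k : nat)
    (U : nat -> 'M[C]_n) : 'M[C]_(n * n) :=
  liouville L *m uhat (recovery_gate k U) *m T *m
  (\big[mulmx/1%:M]_(i <- rev (iota 1 k)) (liouville L *m uhat (U i))) *m
  uhat (U 0%N).

Lemma rb_sequence_with1 (L : 'M[C]_n -> 'M[C]_n) k (U : nat -> 'M[C]_n) :
  rb_sequence_with L 1%:M k U = rb_sequence L k U.
Proof. by rewrite /rb_sequence_with mulmx1. Qed.

Lemma eq_rb_sequence_with (L : 'M[C]_n -> 'M[C]_n) T k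
    (U V : nat -> 'M[C]_n) :
  (forall i, (i <= k)%N -> U i = V i) ->
  rb_sequence_with L T k U = rb_sequence_with L T k V.
Proof.
move=> eUV; rewrite /rb_sequence_with eUV //.
congr (_ *m uhat _ *m _ *m _ *m _).
  by apply: eq_big_nat => i /andP[_ lik]; rewrite eUV.
apply: eq_big_seq => i; rewrite mem_rev mem_iota add1n => /andP[_ lik].
by rewrite eUV.
Qed.

(** The recovery gate ends with the adjoint of the last gate, and the noisy product begins with that
    gate, so these two factors are the neighbours of [T] and can be absorbed into it. *)
Lemma rb_sequence_withS (L : 'M[C]_n -> 'M[C]_n) T k (U : nat -> 'M[C]_n) :
  rb_sequence_with L T k.+1 U =
  rb_sequence_with L
    (uhat ((U k.+1)^t*) *m T *m liouville L *m uhat (U k.+1)) k U.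
Proof.
rewrite /rb_sequence_with /recovery_gate big_nat_recr // uhatM.
(* The index [k.+1] comes last in [iota 1 k.+1], hence first after reversal. *)
have := iotaD 1 k 1; rewrite addn1 add1n cats1 => ->.
by rewrite rev_rcons big_cons !mulmxA.
Qed.

Lemma mean_braket p q (u : 'M[C]_(1, p)) (v : 'M[C]_(q, 1))
    (F : 'M[C]_n -> 'M[C]_(p, q)) :
  domain_mx K F ->
  M (fun U => (u *m F U *m v) 0 0) = (u *m mean_mx M F *m v) 0 0.
Proof.
move=> KF; rewrite -(mean_mulmxl hM) // -(mean_mulmxr hM) ?mxE //.
exact: (domain_mx_mul hM (domain_mx_cst hM _) KF).
Qed.

Lemma mean_rb_sequence_with (L : 'M[C]_n -> 'M[C]_n) (P rho : 'M[C]_n) k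
    (F : 'M[C]_n -> 'M[C]_(n * n)) (U : nat -> 'M[C]_n) :
  domain_mx K F ->
  M (fun V => braket P (rb_sequence_with L (F V) k U) rho) =
  braket P (rb_sequence_with L (mean_mx M F) k U) rho.
Proof.
move=> KF; rewrite /braket /rb_sequence_with.
set A := liouville L *m _; set B := \big[_/_]_(_ <- _) _.
rewrite (_ : (_ *m _) 0 0 =
  ((lvec P)^t* *m A *m mean_mx M F *m (B *m uhat (U 0%N) *m lvec rho)) 0 0).
  rewrite -mean_braket //; congr M; apply/funext => V.
  by rewrite !mulmxA.
by rewrite !mulmxA.
Qed.

(** The list [pre] holds the gates [U_0] to [U_k] that stay fixed. In the induction on [m] the next
    gate joins [pre]: the inner means iterate the twirl on [T], and the mean over that gate adds one
    more twirl. *)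
Lemma iterated_mean_rb_sequence_with (L : 'M[C]_n -> 'M[C]_n)
    (P rho : 'M[C]_n) m k T (pre : seq 'M[C]_n) : size pre = k.+1 ->
  iterated_mean M m (fun s =>
    braket P (rb_sequence_with L T (k + m) (nth 1%:M (pre ++ s))) rho) =
  braket P (rb_sequence_with L (iter m (twirl M (liouville L)) T) k
              (nth 1%:M pre)) rho.
Proof.
elim: m k pre => [|m IHm] k pre szp /=; first by rewrite addn0 cats0.
rewrite -(mean_rb_sequence_with _ _ _ _ _ (domain_twirl _ _)).
congr M; apply/funext => U.
have := IHm k.+1 (rcons pre U); rewrite size_rcons szp => /(_ erefl) e.
under eq_fun do rewrite -cat_rcons addnS -addSn.
rewrite {}e rb_sequence_withS nth_rcons szp ltnn eqxx; congr braket.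
by apply: eq_rb_sequence_with => i lik; rewrite nth_rcons szp ltnS lik.
Qed.

Lemma iterated_mean_rb_survival (L : 'M[C]_n -> 'M[C]_n) (P rho : 'M[C]_n) N :
  iterated_mean M N.+1 (fun s => rb_survival P L rho N (nth 1%:M s)) =
  braket P (liouville L *m iter N (twirl M (liouville L)) 1%:M *m
            mean_mx M uhat) rho.
Proof.
pose A := liouville L *m iter N (twirl M (liouville L)) 1%:M.
rewrite /= -/A.
transitivity (M (fun U => ((lvec P)^t* *m A *m uhat U *m lvec rho) 0 0)).
  congr M; apply/funext => U.
  (* Only [U_0] stays fixed: the recovery gate and the noisy product become empty, and the remaining
     mean acts on [uhat U] alone. *)
  have := @iterated_mean_rb_sequence_with L P rho N 0 1%:M [:: U] erefl.
  rewrite add0n /rb_survival => e.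
  under eq_fun do rewrite -rb_sequence_with1.
  rewrite [LHS]e /braket /rb_sequence_with /recovery_gate big_geq // big_nil.
  by rewrite uhat1 !mulmx1 /= !mulmxA.
by rewrite mean_braket ?/braket ?mulmxA //; exact: (domain_uhat hM).
Qed.

End Twirl.

(** * The projector onto invariant vectors and its products with the twirl *)

Section Commutant.
Local Open Scope sesquilinear_scope.
Context {C : numClosedFieldType} {n : nat}.
Context {G : set 'M[C]_n} {K : ('M[C]_n -> C) -> Prop}
  {M : ('M[C]_n -> C) -> C}.
Hypothesis hM : invariant_mean G K M.
Variables (e1 e2 : 'cV[C]_(n * n)) (d1 d2 : C).
Hypotheses (d1_neq0 : d1 != 0) (d2_neq0 : d2 != 0).
Hypotheses (e11 : e1^t* *m e1 = d1%:M) (e22 : e2^t* *m e2 = d2%:M).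
Hypotheses (e12 : e1^t* *m e2 = 0) (e21 : e2^t* *m e1 = 0).
Hypothesis G_adj : forall U, G U -> G (U^t*).
Hypothesis hinv : forall x : 'cV[C]_(n * n),
  invariant_vector G x <-> x \in <<[:: e1; e2]>>%VS.

Local Notation Pi := (mean_mx M uhat).

Lemma span2P (x : 'cV[C]_(n * n)) : x \in <<[:: e1; e2]>>%VS ->
  exists a b, x = a *: e1 + b *: e2.
Proof.
rewrite span_cons span_seq1 => /memv_addP[_ /vlineP[a ->]] [_ /vlineP[b ->]] ->.
by exists a, b.
Qed.

Lemma uhat_invariant1 U : G U -> uhat U *m e1 = e1.
Proof. by apply: (hinv e1).2; apply: memv_span; rewrite inE eqxx. Qed.

Lemma uhat_invariant2 U : G U -> uhat U *m e2 = e2.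
Proof. by apply: (hinv e2).2; apply: memv_span; rewrite !inE eqxx orbT. Qed.

(** Since [G] is closed under adjoints, invariance of a ket passes to its bra. *)
Lemma uhat_invariant_adj (e : 'cV[C]_(n * n)) :
  (forall U, G U -> uhat U *m e = e) ->
  forall U, G U -> e^t* *m uhat U = e^t*.
Proof.
move=> inv_e U GU.
by rewrite -[uhat U]trmxCK -uhat_adj -adjmx_mul inv_e //; exact: G_adj.
Qed.

(** As [e1] and [e2] are orthogonal with squared norms [d1] and [d2], this is the orthogonal
    projector onto their span. *)
Definition invariant_projector : 'M[C]_(n * n) :=
  d1^-1 *: (e1 *m e1^t*) + d2^-1 *: (e2 *m e2^t*).

Lemma invariant_projectorE (x : 'cV[C]_(n * n)) : invariant_projector *m x =
  ((e1^t* *m x) 0 0 / d1) *: e1 + ((e2^t* *m x) 0 0 / d2) *: e2.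
Proof.
rewrite mulmxDl -!scalemxAl -!mulmxA (mx11_scalar (e1^t* *m x)).
rewrite (mx11_scalar (e2^t* *m x)) !mul_mx_scalar !scalerA.
by rewrite ![_^-1 * _]mulrC !mxE.
Qed.

(** Left invariance makes [Pi *m x] an invariant vector [a *: e1 + b *: e2]. Since [Pi] fixes both
    bras, pairing them with [x] or with [Pi *m x] gives the same numbers, which determine [a] and
    [b]. *)
Lemma mean_uhat : Pi = invariant_projector.
Proof.
have adjPi (e : 'cV[C]_(n * n)) :
    (forall U, G U -> uhat U *m e = e) -> e^t* *m Pi = e^t*.
  move=> inv_e; rewrite -(mean_mulmxl hM); last exact: (domain_uhat hM).
  rewrite -[RHS](mean_mx_cst hM); apply: (mean_mx_ext hM) => U.
  by rewrite inE => GU; exact: uhat_invariant_adj.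
have adj1 := adjPi _ uhat_invariant1; have adj2 := adjPi _ uhat_invariant2.
apply/matrixP => i j.
pose x : 'cV[C]_(n * n) := delta_mx j 0.
suff e : Pi *m x = invariant_projector *m x.
  by have /matrixP/(_ i 0) := e; rewrite -!colE mxE [RHS]mxE.
have /hinv/span2P[a [b ePi]] : invariant_vector G (Pi *m x).
  move=> V GV; rewrite mulmxA -(mean_mulmxl hM); last exact: (domain_uhat hM).
  congr (_ *m _); rewrite -[RHS](mean_mx_invariant hM GV (domain_uhat hM)).
  by congr mean_mx; apply/funext => U; rewrite uhatM.
rewrite invariant_projectorE -{1}adj1 -{1}adj2 -!mulmxA ePi.
rewrite !mulmxDr -!scalemxAr e11 e22 e12 e21 !scaler0 addr0 add0r.
rewrite !mxE !eqxx !mulr1n.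
by rewrite !mulfK.
Qed.

(** The mean commutes with adjoints, and [Pi] is self-adjoint because the squared norms [d1] and
    [d2] are real. *)
Lemma mean_uhat_adj : mean_mx M (fun U => uhat (U^t*)) = Pi.
Proof.
transitivity (Pi^t*).
  rewrite -(mean_mx_adj hM (domain_uhat hM)).
  by congr mean_mx; apply/funext => U; rewrite uhat_adj.
have conj_norm (e : 'cV[C]_(n * n)) d : e^t* *m e = d%:M -> d^*%R = d.
  move=> ed; have := congr1 (fun A : 'M[C]_1 => (A^t*) 0 0) ed.
  by rewrite adjmx_mul trmxCK ed !mxE eqxx !mulr1n => <-.
rewrite mean_uhat /invariant_projector linearD /= !linearZ /= map_mxD !map_mxZ.
rewrite !adjmx_mul !trmxCK !fmorphV /=.
by rewrite (conj_norm _ _ e11) (conj_norm _ _ e22).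
Qed.

Lemma mulmx_mean_uhat U : G U -> uhat U *m Pi = Pi.
Proof.
move=> GU; rewrite mean_uhat mulmxDr -!scalemxAr !mulmxA.
by rewrite uhat_invariant1 // uhat_invariant2.
Qed.

Lemma mean_uhat_mulmx U : G U -> Pi *m uhat U = Pi.
Proof.
move=> GU; rewrite mean_uhat mulmxDl -!scalemxAl -!mulmxA.
rewrite !uhat_invariant_adj //; first exact: uhat_invariant2.
exact: uhat_invariant1.
Qed.

(** [Pi] absorbs the left factor of the twirl, which leaves the mean of the right one. In
    [mul_twirl_mean] the two sides exchange roles. *)
Lemma mul_mean_twirl Lh T : Pi *m twirl M Lh T = Pi *m T *m Lh *m Pi.
Proof.
rewrite -[LHS](mean_mulmxl hM); last exact: (domain_twirl hM).
rewrite -[RHS](mean_mulmxl hM); last exact: (domain_uhat hM).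
apply: (mean_mx_ext hM) => U; rewrite inE => GU.
by rewrite !mulmxA mean_uhat_mulmx //; exact: G_adj.
Qed.

Lemma mul_twirl_mean Lh T : twirl M Lh T *m Pi = Pi *m T *m Lh *m Pi.
Proof.
rewrite -[LHS](mean_mulmxr hM); last exact: (domain_twirl hM).
rewrite -[X in X *m T]mean_uhat_adj -!mulmxA -[RHS](mean_mulmxr hM); last first.
  exact: (domain_uhat_adj hM).
apply: (mean_mx_ext hM) => U; rewrite inE => GU.
by rewrite -!mulmxA mulmx_mean_uhat.
Qed.

(** Next to [Pi], each twirl appends [Lh *m Pi] on the right, while the other side prepends
    [Pi *m Lh]. The iterates commute with [Pi] by the two preceding lemmas, and this reconciles the
    two orders. *)
Lemma iter_twirl_mean Lh N : iter N (twirl M Lh) 1%:M *m Pi =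
  iter N (fun X => Pi *m Lh *m X) Pi.
Proof.
have comm k : Pi *m iter k (twirl M Lh) 1%:M = iter k (twirl M Lh) 1%:M *m Pi.
  case: k => [|k] /=; first by rewrite mulmx1 mul1mx.
  by rewrite mul_mean_twirl mul_twirl_mean.
have shift k : iter k.+1 (twirl M Lh) 1%:M *m Pi =
    Pi *m Lh *m (iter k (twirl M Lh) 1%:M *m Pi).
  elim: k => [|k IHk]; first by rewrite /= mul_twirl_mean mul1mx mulmx1.
  rewrite iterS mul_twirl_mean comm [in LHS]IHk.
  by rewrite iterS mul_twirl_mean comm !mulmxA.
by elim: N => [|N IHN]; [rewrite mul1mx|rewrite shift IHN].
Qed.

End Commutant.

(** * Projectors of the decomposition of the Hilbert space *)

Section Decomposition.
Local Open Scope sesquilinear_scope.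
Context {C : numClosedFieldType} {n : nat}.
Implicit Types (P Q : 'M[C]_n) (H : {vspace 'cV[C]_n}).

Lemma eq_mulmx_col p q (A B : 'M[C]_(p, q)) :
  (forall v : 'cV[C]_q, A *m v = B *m v) -> A = B.
Proof.
move=> eAB; apply/matrixP => i j.
have /matrixP/(_ i 0) := eAB (delta_mx j 0).
by rewrite -!colE !mxE.
Qed.

(** Factor [P] as [B *m D], where the columns of [B] are a basis of [H] and [D] gives the
    coordinates of the columns of [P]. Then [D *m B] is the identity of size [\dim H], with the same
    trace. *)
Lemma mxtrace_projector P H : orthogonal_projector P H -> \tr P = (\dim H)%:R.
Proof.
move=> [_ idemP HP]; pose X := vbasis H.
pose B : 'M[C]_(n, \dim H) := \matrix_(i, j) X`_j i 0.
have mulB (y : 'cV[C]_(\dim H)) : B *m y = \sum_j y j 0 *: X`_j.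
  apply/matrixP => i k; rewrite ord1 mxE summxE.
  by apply: eq_bigr => j _; rewrite !mxE mulrC.
have PB : P *m B = B.
  apply/matrixP => i j; transitivity ((P *m X`_j) i 0).
    by rewrite !mxE; apply: eq_bigr => k _; rewrite mxE.
  rewrite (HP X`_j).1 ?mxE //; apply: vbasis_mem; apply: mem_nth.
  by rewrite size_tuple.
pose D : 'M[C]_(\dim H, n) := \matrix_(i, j) coord X i (col j P).
have PBD : P = B *m D.
  apply/matrixP => i j; have : col j P \in H.
    by apply/HP; rewrite colE mulmxA idemP.
  move=> /coord_vbasis /matrixP/(_ i 0); rewrite mxE => ->; rewrite summxE mxE.
  by apply: eq_bigr => k _; rewrite !mxE mulrC.
(* Multiplied by [B] on the left, both sides give [B], and the columns of [B] are free. *)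
have DB : D *m B = 1%:M.
  apply/matrixP => i j.
  have /freeP freeX := basis_free (vbasisP H).
  pose y := col j (D *m B) - col j 1%:M.
  have : \sum_k y k 0 *: X`_k = 0.
    by rewrite -mulB mulmxBr !colE !mulmxA -PBD PB mulmx1 subrr.
  move=> /freeX /(_ i).
  by rewrite !mxE => /eqP; rewrite subr_eq0 => /eqP.
by rewrite PBD mxtrace_mulC DB mxtrace1.
Qed.

Context {H1 H2 : {vspace 'cV[C]_n}} {P1 P2 : 'M[C]_n}.
Hypotheses (hH : orthogonal_sum H1 H2).
Hypotheses (hP1 : orthogonal_projector P1 H1).
Hypotheses (hP2 : orthogonal_projector P2 H2).

(** As [P1] is self-adjoint, each entry is the inner product of the images of two basis vectors, one
    in [H1] and one in [H2]. *)
Lemma projector_mul0 : P1 *m P2 = 0.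
Proof.
case: hP1 => adj1 idem1 HP1; case: hP2 => _ idem2 HP2; case: hH => orth _.
apply/matrixP => i j.
have in1 : P1 *m (delta_mx i 0 : 'cV[C]_n) \in H1.
  by apply/HP1; rewrite mulmxA idem1.
have in2 : P2 *m (delta_mx j 0 : 'cV[C]_n) \in H2.
  by apply/HP2; rewrite mulmxA idem2.
have /matrixP/(_ 0 0) := orth _ _ in1 in2.
rewrite adjmx_mul adj1 trmx_delta map_delta_mx -mulmxA mulmxA -rowE -colE.
by rewrite !mxE => e; rewrite -[RHS]e; apply: eq_bigr => k _; rewrite !mxE.
Qed.

Lemma projector_mul0r : P2 *m P1 = 0.
Proof.
case: hP1 => adj1 _ _; case: hP2 => adj2 _ _.
by rewrite -[P2]adj2 -[P1]adj1 -adjmx_mul projector_mul0 trmx0 map_mx0.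
Qed.

Lemma projectorD : P1 + P2 = 1%:M.
Proof.
case: hP1 => _ _ HP1; case: hP2 => _ _ HP2; case: hH => _ sumH.
apply: eq_mulmx_col => v; rewrite mul1mx.
have : v \in (H1 + H2)%VS by rewrite sumH memvf.
case/memv_addP => x /HP1 ex [y /HP2 ey ->].
rewrite mulmxDl !mulmxDr ex ey -{1}ey -{2}ex !mulmxA.
by rewrite projector_mul0 projector_mul0r !mul0mx addr0 add0r.
Qed.

Lemma supported_mul0 rho : supported_on rho H1 -> P2 *m rho = 0.
Proof.
case: hP1 => _ _ HP1 supp; apply: eq_mulmx_col => v; rewrite mul0mx -mulmxA.
by have /HP1 <- := supp v; rewrite mulmxA projector_mul0r mul0mx.
Qed.

End Decomposition.

(** * Positive semidefinite matrices and their images under channels *)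

Section Positivity.
Local Open Scope sesquilinear_scope.
Context {C : numClosedFieldType} {n : nat}.

Lemma psd_mxtrace_ge0 m (A : 'M[C]_m) : psd A -> 0 <= \tr A.
Proof.
move=> psdA; apply: sumr_ge0 => i _; have := psdA (delta_mx i 0).
by rewrite trmx_delta map_delta_mx -mulmxA -colE -rowE !mxE.
Qed.

Lemma psd_congr m p (A : 'M[C]_m) (B : 'M[C]_(m, p)) :
  psd A -> psd (B^t* *m A *m B).
Proof. by move=> psdA v; have := psdA (B *m v); rewrite adjmx_mul !mulmxA. Qed.

Lemma psd1 m : psd (1%:M : 'M[C]_m).
Proof.
move=> v; rewrite mulmx1 mxE; apply: sumr_ge0 => i _.
by rewrite !mxE mulrC mul_conjC_ge0.
Qed.

(** Selecting rows and columns along [h] is a congruence by [colsub h 1%:M]. *)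
Lemma psd_mxsub m p (h : 'I_m -> 'I_p) (A : 'M[C]_p) :
  psd A -> psd (mxsub h h A).
Proof.
move=> /(psd_congr (colsub h 1%:M)); congr (psd _).
rewrite trmx_mxsub trmx1 map_mxsub map_mx1 mul_rowsub_mx mul1mx.
by rewrite mulmx_colsub mulmx1; apply/matrixP => i j; rewrite !mxE.
Qed.

(* The instance [k = 1] of complete positivity, read through the
   identification of ['I_(1 * n)] with ['I_n]. *)
Lemma completely_positive_psd (L : 'M[C]_n -> 'M[C]_n) (A : 'M[C]_n) :
  completely_positive L -> psd A -> psd (L A).
Proof.
move=> cpL psdA.
pose f (k : 'I_(1 * n)) := (mxtens_unindex k).2.
pose g (a : 'I_n) : 'I_(1 * n) := mxtens_index (0, a).
have -> : L A = mxsub g g (ampliation L (mxsub f f A)); last first.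
  by apply: psd_mxsub; apply: cpL; exact: psd_mxsub.
apply/matrixP => a b; rewrite mxE /ampliation !big_ord1 tensmxE mxE mul1r.
congr (L _ a b); apply/matrixP => c d.
by rewrite !mxE /f !mxtens_indexK.
Qed.

Lemma mxtrace_projector_ge0 (P A : 'M[C]_n) (H : {vspace 'cV[C]_n}) :
  orthogonal_projector P H -> psd A -> 0 <= \tr (P *m A).
Proof.
move=> [adjP idemP _] /(psd_congr P) /psd_mxtrace_ge0.
by rewrite mxtrace_mulC mulmxA adjP idemP.
Qed.

Lemma orthogonal_projector_psd (P : 'M[C]_n) (H : {vspace 'cV[C]_n}) :
  orthogonal_projector P H -> psd P.
Proof.
move=> [adjP idemP _]; have := psd_congr P (@psd1 n).
by rewrite mulmx1 adjP idemP.
Qed.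

End Positivity.

(** * The two-state Markov chain on the span of the two projectors *)

Section Decay.
Local Open Scope sesquilinear_scope.
Context {C : numClosedFieldType} {n : nat}.
Variables (H1 H2 : {vspace 'cV[C]_n}) (P1 P2 : 'M[C]_n) (G : set 'M[C]_n).
Variables (Lam : {linear 'M[C]_n -> 'M[C]_n}) (rho : 'M[C]_n).
Hypotheses (hH : orthogonal_sum H1 H2).
Hypotheses (hd1 : (1 <= \dim H1)%N) (hd2 : (1 <= \dim H2)%N).
Hypotheses (hP1 : orthogonal_projector P1 H1).
Hypotheses (hP2 : orthogonal_projector P2 H2).
Hypothesis hinv : forall x : 'cV[C]_(n * n),
  invariant_vector G x <-> x \in <<[:: lvec P1; lvec P2]>>%VS.
Hypothesis hLam : channel Lam.
Hypotheses (hrho : density rho) (hsupp : supported_on rho H1).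

Local Notation d1 := ((\dim H1)%:R : C).
Local Notation d2 := ((\dim H2)%:R : C).
Local Notation L := (leakage (\dim H1) P1 P2 Lam).
Local Notation S := (seepage (\dim H2) P1 P2 Lam).

Let adj1 : P1^t* = P1. Proof. by case: hP1. Qed.
Let adj2 : P2^t* = P2. Proof. by case: hP2. Qed.

Let d1_neq0 : d1 != 0. Proof. by rewrite pnatr_eq0 -lt0n. Qed.
Let d2_neq0 : d2 != 0. Proof. by rewrite pnatr_eq0 -lt0n. Qed.

Lemma leakage_ge0 : 0 <= L.
Proof.
rewrite /leakage braket_lvec mulr_ge0 ?invr_ge0 ?ler0n // adj2.
apply: mxtrace_projector_ge0 hP2 _; case: hLam => cp _.
exact: completely_positive_psd cp (orthogonal_projector_psd hP1).
Qed.

Lemma seepage_ge0 : 0 <= S.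
Proof.
rewrite /seepage braket_lvec mulr_ge0 ?invr_ge0 ?ler0n // adj1.
apply: mxtrace_projector_ge0 hP1 _; case: hLam => cp _.
exact: completely_positive_psd cp (orthogonal_projector_psd hP2).
Qed.

Let tr_Lam A : \tr (P1 *m Lam A) + \tr (P2 *m Lam A) = \tr A.
Proof.
rewrite -mxtraceD -mulmxDl (projectorD hH hP1 hP2) mul1mx.
by case: hLam => _ ->.
Qed.

(** The next four facts give the transition weights: those between the subspaces come from the
    definitions of leakage and seepage, the diagonal ones follow by trace preservation. *)
Let b21 : braket P2 (liouville Lam) P1 = d1 * L.
Proof. by rewrite /leakage mulVKf. Qed.

Let b12 : braket P1 (liouville Lam) P2 = d2 * S.
Proof. by rewrite /seepage mulVKf. Qed.

Let b11 : braket P1 (liouville Lam) P1 = d1 * (1 - L).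
Proof.
rewrite mulrBr mulr1 -b21 !braket_lvec adj1 adj2 -(mxtrace_projector hP1).
by rewrite -(tr_Lam P1) addrK.
Qed.

Let b22 : braket P2 (liouville Lam) P2 = d2 * (1 - S).
Proof.
rewrite mulrBr mulr1 -b12 !braket_lvec adj1 adj2 -(mxtrace_projector hP2).
by rewrite -(tr_Lam P2) addrC addKr.
Qed.

Let dot_mx1 (A B : 'M[C]_n) : (lvec A)^t* *m lvec B = (\tr (A^t* *m B))%:M.
Proof. by rewrite -lvec_dot -mx11_scalar. Qed.

Let dotE A a b :
  ((lvec A)^t* *m (liouville Lam *m (a *: lvec P1 + b *: lvec P2))) 0 0 =
  a * braket A (liouville Lam) P1 + b * braket A (liouville Lam) P2.
Proof.
rewrite !mulmxDr -!scalemxAr !mulmxA [LHS]mxE.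
by congr (_ + _); rewrite [LHS]mxE.
Qed.

Context {K : ('M[C]_n -> C) -> Prop} {M : ('M[C]_n -> C) -> C}.
Hypothesis hM : invariant_mean G K M.
Hypothesis G_adj : forall U, G U -> G (U^t*).

(* The weight on [H1] of the twirled state after [k] noisy gates. *)
Definition population k : C := iter k (fun u => (1 - L - S) * u + S) 1.

(** Dividing by [d1] and [d2] gives the projectors unit trace, so the coefficients are the two
    probabilities of the chain. *)
Lemma iter_twirl_population N :
  iter N (twirl M (liouville Lam)) 1%:M *m mean_mx M uhat *m lvec rho =
  (population N / d1) *: lvec P1 + ((1 - population N) / d2) *: lvec P2.
Proof.
have e11 : (lvec P1)^t* *m lvec P1 = d1%:M.
  by rewrite dot_mx1 adj1 -(mxtrace_projector hP1); case: hP1 => _ ->.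
have e22 : (lvec P2)^t* *m lvec P2 = d2%:M.
  by rewrite dot_mx1 adj2 -(mxtrace_projector hP2); case: hP2 => _ ->.
have e12 : (lvec P1)^t* *m lvec P2 = 0.
  by rewrite dot_mx1 adj1 (projector_mul0 hH hP1 hP2) mxtrace0 raddf0.
have e21 : (lvec P2)^t* *m lvec P1 = 0.
  by rewrite dot_mx1 adj2 (projector_mul0r hH hP1 hP2) mxtrace0 raddf0.
rewrite (iter_twirl_mean hM d1_neq0 d2_neq0 e11 e22 e12 e21 G_adj hinv).
have PiE := mean_uhat hM d1_neq0 d2_neq0 e11 e22 e12 e21 G_adj hinv.
elim: N => [|N IHN] /=.
  rewrite PiE invariant_projectorE !lvec_dot adj1 adj2.
  rewrite (supported_mul0 hH hP1 hP2 hsupp) mxtrace0 subrr.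
  (* The chain starts in [H1], because [P2] annihilates [rho] and [rho] has trace one. *)
  suff -> : \tr (P1 *m rho) = 1 by [].
  have [_ tr_rho] := hrho; rewrite -[RHS]tr_rho -[in RHS](mul1mx rho).
  rewrite -(projectorD hH hP1 hP2).
  by rewrite mulmxDl (supported_mul0 hH hP1 hP2 hsupp) addr0.
rewrite -!mulmxA IHN PiE invariant_projectorE !dotE b11 b12 b21 b22.
congr (_ / _ *: _ + _ / _ *: _).
  by field; rewrite d1_neq0 d2_neq0.
by field; rewrite d1_neq0 d2_neq0.
Qed.

(** The channel that follows the recovery gate makes one further step of the chain, hence the index
    [N.+1]. *)
Lemma mean_rb_survival N :
  iterated_mean M N.+1 (fun s => rb_survival P1 Lam rho N (nth 1%:M s)) =
  population N.+1.
Proof.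
rewrite (iterated_mean_rb_survival hM) /braket.
rewrite -mulmxA -[liouville Lam *m _ *m _]mulmxA.
rewrite -[liouville Lam *m _ *m _]mulmxA.
rewrite iter_twirl_population dotE b11 b12 /=; field.
by rewrite d1_neq0 d2_neq0.
Qed.

(** The hypothesis says that [B] is a fixed point of the recursion, so the deviation from [B] is
    multiplied by [1 - L - S] at each step. *)
Lemma population_geometric (B : C) N : S = B * (L + S) ->
  population N = B + (1 - B) * (1 - L - S) ^+ N.
Proof.
move=> eS; elim: N => [|N IHN]; first by rewrite expr0 mulr1 addrC subrK.
have eS' : S = B * (1 - (1 - L - S)) by rewrite [LHS]eS; congr (B * _); ring.
rewrite /= IHN exprS; move: eS'; move: (1 - L - S) => lambda ->; ring.
Qed.

End Decay.

(** * Real constants of the decay *)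

Section RealDecay.
Context {R : realType}.

Lemma rb_decay_population (l s : R) (S0 : nat -> R[i]) :
  0 <= l -> 0 <= s ->
  (forall N (B : R[i]), s%:C = B * (l%:C + s%:C) ->
     S0 N = B + (1 - B) * (1 - l%:C - s%:C) ^+ N.+1) ->
  rb_decay l%:C s%:C S0.
Proof.
(* When [l + s] vanishes, so do [l] and [s] by nonnegativity, and the fixed-point equation holds for
   the default value 1. *)
move=> l0 s0 hS0; pose B := if l + s == 0 then 1 else s / (l + s).
have hs : s = B * (l + s).
  rewrite /B; case: eqVneq => [ls0|ne]; last by rewrite mulfVK.
  rewrite ls0 mulr0; lra.
(* The extra factor in the first constant absorbs the shift from exponent [N.+1] to [N]. *)
exists ((1 - B) * (1 - l - s)), B, (1 - l - s); split.
- by rewrite !rmorphB rmorph1.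
- move=> N _; rewrite (hS0 N B%:C) -?rmorphD -?rmorphM -?hs //.
  rewrite -mulrA -exprS [LHS]addrC.
  by rewrite !(rmorphD, rmorphM, rmorphN, rmorphXn, rmorph1).
- congr real_complex_def; rewrite {1}(_ : l = l + s - B * (l + s)).
    ring.
  by rewrite -hs; ring.
- by congr real_complex_def; rewrite [LHS]hs; congr (_ * _); ring.
Qed.

End RealDecay.

(** * Uniform averages over a finite group *)

Section FiniteMean.
Local Open Scope sesquilinear_scope.
Context {C : numClosedFieldType} {n : nat}.

Definition finite_mean (G : set 'M[C]_n) (f : 'M[C]_n -> C) : C :=
  (#|` fset_set G|%fset)%:R^-1 * \sum_(U \in G) f U.

Lemma unitary_group_mulVK (G : set 'M[C]_n) (U V : 'M[C]_n) :
  unitary_group G -> G U ->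
  U^t* *m (U *m V) = V /\ U *m (U^t* *m V) = V.
Proof.
move=> [_ _ _ uG] GU; have /unitarymxP UU := uG U GU.
by rewrite !mulmxA UU (mulmx1C UU) !mul1mx.
Qed.

Lemma finite_invariant_mean (G : set 'M[C]_n) :
  finite_set G -> unitary_group G ->
  invariant_mean G (fun=> True) (finite_mean G).
Proof.
move=> finG gG; have [G1 GM GV uG] := gG.
have c0 : (#|` fset_set G|%fset)%:R != 0 :> C.
  rewrite pnatr_eq0 cardfs_eq0; apply/eqP => e.
  by have : 1%:M \in fset_set G; [rewrite in_fset_set // inE|rewrite e inE].
split=> //.
- move=> a f g _ _; rewrite /finite_mean !fsbig_finite //= big_split /=.
  by rewrite -mulr_sumr mulrDr mulrCA.
- move=> f _; rewrite /finite_mean !fsbig_finite //= rmorphM fmorphV rmorph_nat.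
  by rewrite rmorph_sum.
- move=> a; rewrite /finite_mean fsbig_finite //= big_const_seq count_predT.
  by rewrite iter_addr_0 -[a *+ _]mulr_natl mulKf.
- by move=> f g efg; rewrite /finite_mean (eq_fsbigr g).
- move=> V f GV' _; rewrite /finite_mean [in RHS](reindex_fsbig (mulmx V) G) //.
  split=> [U GU|U W _ _ e|U GU]; first exact: GM.
    have [<- _] := unitary_group_mulVK U gG GV'.
    by rewrite e; have [-> _] := unitary_group_mulVK W gG GV'.
  exists (V^t* *m U); first by apply: GM => //; exact: GV.
  by have [_ ->] := unitary_group_mulVK U gG GV'.
Qed.

Definition tuples_in (G : set 'M[C]_n) m : set (m.-tuple 'M[C]_n) :=
  [set t | forall i, G (tnth t i)].
Arguments tuples_in G m _ : clear implicits.

Lemma tuples_in_cons (G : set 'M[C]_n) m :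
  set_bij (G `*` tuples_in G m) (tuples_in G m.+1)
    (fun p => [tuple of p.1 :: p.2]).
Proof.
split=> [[U t] [GU Gt] i|[U t] [V s] _ _ /= e|t Gt] /=.
- by case: (unliftP ord0 i) => [j ->|->]; rewrite ?tnth0 // tnthS; exact: Gt.
- by have := congr1 val e; case=> -> ets; congr pair; exact: val_inj.
- exists (thead t, [tuple of behead t]) => /=; last by rewrite -tuple_eta.
  split=> [|i]; first exact: Gt.
  by rewrite tnth_behead; exact: Gt.
Qed.

Lemma finite_tuples_in (G : set 'M[C]_n) m :
  finite_set G -> finite_set (tuples_in G m).
Proof.
move=> finG; elim: m => [|m IHm].
  apply: (sub_finite_set (B := [set [tuple]])) => // t _.
  by rewrite /= [t]tuple0.
have [_ _ surj] := tuples_in_cons G m.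
by apply: sub_finite_set surj _; apply/finite_image/finite_setX.
Qed.

(** [tuples_in_cons] splits the sum into one over the first gate and one over the others, and each
    mean receives one factor of the normalisation. *)
Lemma iterated_finite_mean (G : set 'M[C]_n) m (f : seq 'M[C]_n -> C) :
  finite_set G ->
  ((#|` fset_set G|%fset)%:R ^+ m)^-1 * \sum_(t \in tuples_in G m) f t =
  iterated_mean (finite_mean G) m f.
Proof.
move=> finG; elim: m f => [|m IHm] f.
  rewrite expr0 invr1 mul1r (_ : tuples_in G 0 = [set [tuple]]) ?fsbig_set1 //.
  by apply/seteqP; split=> [t _|t _ []] //; rewrite /= [t]tuple0.
rewrite /= /finite_mean.
under [X in _ = _ * X]eq_fsbigr do rewrite -IHm.
rewrite (reindex_fsbig _ _ _ _ (@tuples_in_cons G m)) /=.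
rewrite -(pair_fsbig _ (fun U (t : m.-tuple 'M[C]_n) => f (U :: t))) //;
  last exact: finite_tuples_in.
rewrite exprS invfM -mulrA; congr (_ * _).
by rewrite !(fsbig_finite _ _ finG) /= mulr_sumr.
Qed.

End FiniteMean.

(** * Continuity of complex and matrix-valued functions *)

Section ComplexContinuity.
Context {R : realType}.

(** A neighbourhood of a matrix contains a product of neighbourhoods of its finitely many
    entries. *)
Lemma continuous_mx (T : topologicalType) m p (f : T -> 'M[R[i]]_(m, p)) :
  (forall i j, continuous (fun x => f x i j)) -> continuous f.
Proof.
move=> cf x A [P nP sPA].
have : \forall y \near x, forall ij : 'I_m * 'I_p, P ij.1 ij.2 (f y ij.1 ij.2).
  by apply: filter_forall => ij; exact: (cf ij.1 ij.2 x _ (nP ij.1 ij.2)).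
by apply: filterS => y fyP; apply: sPA => i j; exact: (fyP (i, j)).
Qed.

Lemma continuous_Re : continuous (@complex.Re R).
Proof.
move=> x A /nbhs_ballP[e /= e0 sA]; apply/nbhs_ballP; exists e%:C => /=.
  by rewrite ltcR.
move=> y xy; apply: sA; rewrite /ball /= -ltcR.
apply: le_lt_trans xy.
rewrite (_ : complex.Re x - complex.Re y = complex.Re (x - y)).
  exact: normc_ge_Re.
by rewrite raddfB.
Qed.

Lemma continuous_conj : continuous (Num.conj : R[i] -> R[i]).
Proof.
move=> x A /nbhs_ballP[e /= e0 sA]; apply/nbhs_ballP; exists e => //= y xy.
by apply: sA; rewrite /ball /= -rmorphB norm_conjC.
Qed.

(** Multiplication by the imaginary unit reduces this to the bound on the real part. *)
Lemma normc_ge_Im (z : R[i]) : `|complex.Im z|%:C <= `|z|.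
Proof.
have := normc_ge_Re (z * 'i%C); rewrite ReiNIm normrN normrM.
suff -> : `|'i%C : R[i]| = 1 by rewrite mulr1.
by rewrite normc_def /= expr0n expr1n add0r sqrtr1.
Qed.

Lemma continuous_Im : continuous (@complex.Im R).
Proof.
move=> x A /nbhs_ballP[e /= e0 sA]; apply/nbhs_ballP; exists e%:C => /=.
  by rewrite ltcR.
move=> y xy; apply: sA; rewrite /ball /= -ltcR.
apply: le_lt_trans xy.
rewrite (_ : complex.Im x - complex.Im y = complex.Im (x - y)).
  exact: normc_ge_Im.
by rewrite raddfB.
Qed.

End ComplexContinuity.

(** * Haar averages over a compact group *)

Section HaarMean.
Local Open Scope sesquilinear_scope.
Context {R : realType} {n : nat}.
Variables (G : set 'M[R[i]]_n) (mu : probability (@borel_mx R n) R).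
Hypotheses (gG : unitary_group G) (cG : compact G) (hmu : haar G mu).
Let Gb : set (@borel_mx R n) := G.

(** A compact subset of a Hausdorff space is closed, hence Borel. *)
Lemma compact_measurable_borel_mx : measurable Gb.
Proof.
have closedG : closed G.
  apply: compact_closed cG; exact: (@norm_hausdorff _ 'M[R[i]]_n).
rewrite -[Gb]setCK; apply: measurableC; apply: sub_sigma_algebra.
exact: closed_openC closedG.
Qed.

Lemma continuous_measurable_borel_mx (h : 'M[R[i]]_n -> R) :
  continuous h -> measurable_fun setT (h : @borel_mx R n -> R).
Proof.
move=> /continuousP ch; apply: (measurability _ (RGenOpens.measurableE R)).
move=> _ [_ [a [b ->] <-]]; rewrite setTI; apply: sub_sigma_algebra.
exact/ch/interval_open.
Qed.

Lemma continuous_mulmxl (V : 'M[R[i]]_n) :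
  continuous (fun U : 'M[R[i]]_n => V *m U).
Proof.
apply: continuous_mx => i j.
have -> : (fun U : 'M[R[i]]_n => (V *m U) i j) =
    (fun U : 'M[R[i]]_n => \sum_k V i k * U k j).
  by apply: funext => U; rewrite mxE.
apply: continuous_big => [|k _ x]; first exact: add_continuous.
by apply: continuousM; [exact: cst_continuous|exact: coord_continuous].
Qed.

Lemma measurable_mulmxl (V : 'M[R[i]]_n) :
  measurable_fun setT
    ((fun U : 'M[R[i]]_n => V *m U) : @borel_mx R n -> @borel_mx R n).
Proof.
apply: (measurability _ (erefl : @measurable _ (@borel_mx R n) = <<s open >>)).
move=> _ [A oA <-]; rewrite setTI; apply: sub_sigma_algebra.
by move: A oA; apply/continuousP; exact: continuous_mulmxl.
Qed.

(** A continuous function is bounded on the compact set [G], which has finite measure. *)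
Lemma continuous_integrable_haar (h : 'M[R[i]]_n -> R) :
  continuous h -> mu.-integrable Gb (EFin \o (h : @borel_mx R n -> R)).
Proof.
move=> ch; apply: measurable_bounded_integrable.
- exact: compact_measurable_borel_mx.
- rewrite (le_lt_trans (probability_le1 _ _)) ?ltry//.
  exact: compact_measurable_borel_mx.
- by apply: measurable_funTS; exact: continuous_measurable_borel_mx.
- have : bounded_set (h @` G).
    apply: compact_bounded; apply: continuous_compact => //.
    exact: continuous_subspaceT.
  move=> [B [Br hB]]; exists B; split=> // y By x Gx; apply: hB By _ _.
  by exists x.
Qed.

(** Translation by [V] preserves [G], and its pushforward of [mu] agrees with [mu] on Borel sets, so
    the claim is a change of variables. *)
Lemma haar_integral_invariant (h : 'M[R[i]]_n -> R) V : G V -> continuous h ->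
  \int[mu]_(U in Gb) h (V *m U) = \int[mu]_(U in Gb) h U.
Proof.
move=> GV ch; have [_ inv_mu] := hmu; have [G1 GM GVv uG] := gG.
pose phi : @borel_mx R n -> @borel_mx R n := fun U => V *m U.
have preG : phi @^-1` Gb = Gb.
  apply/seteqP; split=> U /= GU; last exact: GM.
  have [<- _] := unitary_group_mulVK U gG GV.
  by apply: GM => //; exact: GVv.
have mh : measurable_fun setT (EFin \o (h : @borel_mx R n -> R)).
  by apply/measurable_EFinP; exact: continuous_measurable_borel_mx.
have ih : mu.-integrable (phi @^-1` Gb)
    ((EFin \o (h : @borel_mx R n -> R)) \o phi).
  rewrite preG; apply: (@continuous_integrable_haar (fun U => h (V *m U))) => x.
  by apply: continuous_comp; [exact: continuous_mulmxl|exact: ch].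
have E := integral_pushforward (measurable_mulmxl V) mh ih
  compact_measurable_borel_mx.
rewrite preG in E; congr fine; rewrite -[LHS]E.
apply: eq_measure_integral => [|mphi A mA _]; first exact: measurable_mulmxl.
exact: (inv_mu V GV A mA).
Qed.

Lemma haar_invariant_mean : invariant_mean G
  (fun f : 'M[R[i]]_n -> R[i] => continuous f) (cintegral mu G).
Proof.
have mG := compact_measurable_borel_mx.
have cRe (f : 'M[R[i]]_n -> R[i]) : continuous f ->
    continuous (fun U => complex.Re (f U)).
  by move=> cf x; apply: continuous_comp; [exact: cf|exact: continuous_Re].
have cIm (f : 'M[R[i]]_n -> R[i]) : continuous f ->
    continuous (fun U => complex.Im (f U)).
  by move=> cf x; apply: continuous_comp; [exact: cf|exact: continuous_Im].
have cZ a (f : 'M[R[i]]_n -> R) : continuous f -> continuous (fun U => a * f U).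
  by move=> cf x; apply: continuousM; [exact: cst_continuous|exact: cf].
have cD (f g : 'M[R[i]]_n -> R) : continuous f -> continuous g ->
    continuous (fun U => f U + g U).
  by move=> cf cg x; apply: continuousD; [exact: cf|exact: cg].
(* A complex scalar mixes real and imaginary parts, so each part of complex linearity needs a real
   combination of three integrals. *)
have lin a b (f g h : 'M[R[i]]_n -> R) :
    continuous f -> continuous g -> continuous h ->
    \int[mu]_(U in Gb) (a * f U + b * g U + h U) =
    a * \int[mu]_(U in Gb) f U + b * \int[mu]_(U in Gb) g U
      + \int[mu]_(U in Gb) h U.
  move=> cf cg ch; have caf := cZ a _ cf; have cbg := cZ b _ cg.
  have cab := cD _ _ caf cbg.
  rewrite (RintegralD mG (continuous_integrable_haar cab)); last first.
    exact: continuous_integrable_haar.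
  rewrite (RintegralD mG (continuous_integrable_haar caf)); last first.
    exact: continuous_integrable_haar.
  by rewrite !RintegralZl //; exact: continuous_integrable_haar.
split.
- by move=> i j; exact: coord_continuous.
- by move=> a; exact: cst_continuous.
- by move=> f g cf cg x; apply: continuousD; [exact: cf|exact: cg].
- by move=> f g cf cg x; apply: continuousM; [exact: cf|exact: cg].
- by move=> f cf x; apply: continuous_comp; [exact: cf|exact: continuous_conj].
- move=> [a b] f g cf cg; rewrite /cintegral; apply/eqP; rewrite eq_complex /=.
  apply/andP; split; apply/eqP.
  + transitivity (\int[mu]_(U in Gb) (a * complex.Re (f U) +
      (- b) * complex.Im (f U) + complex.Re (g U))).
      apply: eq_Rintegral => U _; case: (f U) (g U) => p q [r s] /=; ring.
    by rewrite lin; [ring|exact: cRe|exact: cIm|exact: cRe].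
  + transitivity (\int[mu]_(U in Gb) (a * complex.Im (f U) +
      b * complex.Re (f U) + complex.Im (g U))).
      apply: eq_Rintegral => U _; case: (f U) (g U) => p q [r s] /=; ring.
    by rewrite lin; [ring|exact: cIm|exact: cRe|exact: cIm].
- move=> f cf; rewrite /cintegral; apply/eqP; rewrite eq_complex /=.
  apply/andP; split; apply/eqP.
    by apply: eq_Rintegral => U _; case: (f U).
  transitivity (\int[mu]_(U in Gb) (-1 * complex.Im (f U))).
    by apply: eq_Rintegral => U _; case: (f U) => p q /=; rewrite mulN1r.
  rewrite RintegralZl ?mulN1r //; apply: continuous_integrable_haar.
  exact: cIm.
- move=> a; rewrite /cintegral !Rintegral_cst //.
  have muG : fine (mu Gb) = 1 by have [e _] := hmu; rewrite [mu Gb]e.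
  by rewrite [fine _]muG !mulr1; case: a.
- move=> f g efg; rewrite /cintegral.
  by congr (_ +i* _); apply: eq_Rintegral => U GU; rewrite efg.
- move=> V f GV cf; rewrite /cintegral.
  congr (_ +i* _).
    exact: (haar_integral_invariant GV (cRe _ cf)).
  exact: (haar_integral_invariant GV (cIm _ cf)).
Qed.

Lemma haar_averageE m (f : seq 'M[R[i]]_n -> R[i]) :
  haar_average mu G m f = iterated_mean (cintegral mu G) m f.
Proof. by elim: m f => [|m IHm] f //=; congr cintegral; apply/funext => U. Qed.

End HaarMean.

Theorem mainTheorem5 (R : realType) (n : nat)
    (H1 H2 : {vspace 'cV[R[i]]_n}) (P1 P2 : 'M[R[i]]_n)
    (G : set 'M[R[i]]_n) (Lam : {linear 'M[R[i]]_n -> 'M[R[i]]_n})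
    (rho : 'M[R[i]]_n)
    (hH : orthogonal_sum H1 H2)
    (hd1 : (1 <= \dim H1)%N) (hd2 : (1 <= \dim H2)%N)
    (hP1 : orthogonal_projector P1 H1) (hP2 : orthogonal_projector P2 H2)
    (hG : unitary_group G) (hG1 : preserves G H1) (hG2 : preserves G H2)
    (hinv : forall x : 'cV[R[i]]_(n * n),
      invariant_vector G x <-> x \in <<[:: lvec P1; lvec P2]>>%VS)
    (hLam : channel Lam)
    (hrho : density rho) (hsupp : supported_on rho H1) :
  let L := leakage (\dim H1) P1 P2 Lam in
  let S := seepage (\dim H2) P1 P2 Lam in
  (finite_set G -> rb_decay L S (S0_finite G P1 Lam rho)) /\
  (compact G -> forall mu : probability borel_mx R, haar G mu ->
     rb_decay L S (S0_haar mu G P1 Lam rho)).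
Proof.
move=> L S.
have leak0 : 0 <= L := leakage_ge0 hP1 hP2 hLam.
have seep0 : 0 <= S := seepage_ge0 hP1 hP2 hLam.
have G_adj : forall U, G U -> G (U ^t*)%sesqui by case: hG.
(* In [R[i]], nonnegativity includes being real, so leakage and seepage come from nonnegative
   reals. *)
have real_of (z : R[i]) : 0 <= z -> exists2 x : R, 0 <= x & z = x%:C.
  by move=> z0; exists (complex.Re z); rewrite -?lecR RRe_real ?ger0_real.
have [l l0 eL] := real_of _ leak0; have [s s0 eS] := real_of _ seep0.
(* The finite and Haar cases differ only in the invariant mean supplied here. *)
have decay K M (S0 : nat -> R[i]) : invariant_mean G K M ->
    (forall N, S0 N = iterated_mean M N.+1
       (fun t => rb_survival P1 Lam rho N (nth 1%:M t))) -> rb_decay L S S0.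
  move=> hM eS0; rewrite eL eS; apply: rb_decay_population => // N B eB.
  rewrite eS0.
  rewrite (mean_rb_survival hH hd1 hd2 hP1 hP2 hinv hLam hrho hsupp hM G_adj).
  rewrite (population_geometric _ (B := B)) -/L -/S eL eS //.
split=> [finG|cG mu hmu].
- apply: (decay _ _ _ (finite_invariant_mean finG hG)) => N.
  by rewrite -iterated_finite_mean.
- apply: (decay _ _ _ (haar_invariant_mean hG cG hmu)) => N.
  by rewrite -haar_averageE.
Qed.
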